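(* Let $J\in\mathcal{G}_{\mathcal{S}}\setminus\mathcal{G}_{\mathcal{S}}^{0}$ be the involution interchanging $e_i\leftrightarrow e_{9-i}$ for $i=1,\ldots,8$. Then $JWJ^{-1}=W^{2}$, and the subgroup $\mathcal{Z}=\langle W\rangle$ of $\operatorname{GL}(8,2)$ satisfies $$A\mathcal{Z}A^{-1}=\mathcal{Z}\quad\text{for all }A\in\mathcal{G}_{\mathcal{S}}.$$
   Context: Everything is over $\operatorname{GF}(2)$. Let $V_2$ be a 2-dimensional vector space over $\operatorname{GF}(2)$ with nonzero vectors $u_0,u_1,u_2$ (so $u_2=u_0+u_1$), $V_8=V_2\otimes V_2\otimes V_2$, and $\operatorname{GL}(8,2)=\operatorname{GL}(V_8)$. Put $E_{ijk}=u_i\otimes u_j\otimes u_k$ for $i,j,k\in\{0,1,2\}$. The Segre variety is the set $\mathcal{S}=\mathcal{S}_{1,1,1}(2)=\{E_{ijk}\}$ of 27 points of $\operatorname{PG}(7,2)=\mathbb{P}V_8$ (points are identified with nonzero vectors). Its stabilizer in $\operatorname{GL}(V_8)$ is $\mathcal{G}_{\mathcal{S}}=\mathcal{N}\rtimes\operatorname{Sym}(3)$ (order 1296), where $\mathcal{N}=\operatorname{GL}(V_2)\times\operatorname{GL}(V_2)\times\operatorname{GL}(V_2)$ acts by the maps $a_1\otimes a_2\otimes a_3$ and $\operatorname{Sym}(3)$ acts by permuting the three tensor factors. Let $\mathcal{H}\cong Z_3$ be the index 2 subgroup of $\operatorname{GL}(V_2)$; let $\mathcal{N}_0$ be the index 2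 subgroup of $\mathcal{N}$ consisting of those $a_1\otimes a_2\otimes a_3$ for which an even number (0 or 2) of the $a_i$ lie in $\operatorname{GL}(V_2)\setminus\mathcal{H}$; and $\mathcal{G}_{\mathcal{S}}^{0}=\mathcal{N}_0\rtimes\operatorname{Sym}(3)$. The basis is $e_1=E_{000},\ e_2=E_{100},\ e_3=E_{110},\ e_4=E_{010},\ e_5=E_{101},\ e_6=E_{001},\ e_7=E_{011},\ e_8=E_{111}$. The map $W\in\operatorname{GL}(V_8)$ is the linear map, of order 3, given by $e_1\mapsto e_2+e_4+e_6$, $e_2\mapsto e_2+e_1+e_3+e_5$, $e_3\mapsto e_2+e_4+e_8$, $e_4\mapsto e_4+e_1+e_3+e_7$, $e_5\mapsto e_2+e_6+e_8$, $e_6\mapsto e_6+e_1+e_5+e_7$, $e_7\mapsto e_4+e_6+e_8$, $e_8\mapsto e_8+e_3+e_5+e_7$. *)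

(* Defs.v *)
From mathcomp Require Import all_boot all_order all_algebra all_fingroup.
From mathcomp Require Import mxtens.

Set Implicit Arguments.
Unset Strict Implicit.
Unset Printing Implicit Defensive.

Import GRing.Theory.
Local Open Scope ring_scope.

(* V_2 is GF(2)^2 and V_8 is GF(2)^(2*2*2); vectors are columns, so that a    *)
(* matrix acts on the left and the product of the group {'GL_8(2)} is the     *)
(* composition of maps.                                                       *)
Notation V2 := 'cV['F_2]_2.
Notation V8 := 'cV['F_2]_8.

(* The Kronecker products live in dimensions 2 * 2 * 2 and 1 * 1 * 1, which   *)
(* are convertible to 8 and 1.                                                *)
Definition tens3 (x y z : V2) : V8 := ((x *t y) *t z : 'M['F_2]_(2 * 2 * 2, 1)).

Definition tens3_mx (a1 a2 a3 : 'M['F_2]_2) : 'M['F_2]_8 :=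
  ((a1 *t a2) *t a3 : 'M['F_2]_(2 * 2 * 2, 2 * 2 * 2)).

Definition GLact (A : {'GL_8(2)}) (x : V8) : V8 := GLval A *m x.

(* V_2 has exactly three nonzero vectors, so u enumerates all of them.        *)
Definition nonzero_enum (u : 'I_3 -> V2) : Prop :=
  injective u /\ forall i, u i != 0.

Section SegreVariety.

Variable u : 'I_3 -> V2.

Definition E (i j k : 'I_3) : V8 := tens3 (u i) (u j) (u k).

(* Points of PG(7,2) are identified with nonzero vectors of V_8.              *)
Definition Segre : {set V8} :=
  [set E t.1.1 t.1.2 t.2 | t in [set: 'I_3 * 'I_3 * 'I_3]].

Definition GS : {set {'GL_8(2)}} :=
  [set A : {'GL_8(2)} | GLact A @: Segre == Segre].

(* The basis e_1, ..., e_8, with 1-based indices.                             *)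
Definition e (i : nat) : V8 :=
  nth 0 [:: E 0 0 0; E 1 0 0; E 1 1 0; E 0 1 0;
            E 1 0 1; E 0 0 1; E 0 1 1; E 1 1 1] i.-1.

Definition W_spec (W : {'GL_8(2)}) : Prop :=
  [/\ [/\ GLact W (e 1) = e 2 + e 4 + e 6,
          GLact W (e 2) = e 2 + e 1 + e 3 + e 5,
          GLact W (e 3) = e 2 + e 4 + e 8
        & GLact W (e 4) = e 4 + e 1 + e 3 + e 7],
      GLact W (e 5) = e 2 + e 6 + e 8,
      GLact W (e 6) = e 6 + e 1 + e 5 + e 7,
      GLact W (e 7) = e 4 + e 6 + e 8
    & GLact W (e 8) = e 8 + e 3 + e 5 + e 7].

Definition J_spec (J : {'GL_8(2)}) : Prop :=
  forall i : nat, (1 <= i <= 8)%N -> GLact J (e i) = e (9 - i).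

End SegreVariety.

Definition N0 (H : {group {'GL_2(2)}}) : {set {'GL_8(2)}} :=
  [set A : {'GL_8(2)} |
    [exists a1 : {'GL_2(2)}, exists a2 : {'GL_2(2)}, exists a3 : {'GL_2(2)},
       (GLval A == tens3_mx (GLval a1) (GLval a2) (GLval a3))
       && ~~ odd ((a1 \notin H) + (a2 \notin H) + (a3 \notin H))%N]].

Definition Sym3 : {set {'GL_8(2)}} :=
  [set A : {'GL_8(2)} |
    [exists s : 'S_3, forall v : {ffun 'I_3 -> V2},
       GLact A (tens3 (v 0) (v 1) (v ord_max))
         == tens3 (v (s 0)) (v (s 1)) (v (s ord_max))]].

(* The underlying set of the semidirect product N_0 ><| Sym(3).               *)
Definition GS0 (H : {group {'GL_2(2)}}) : {set {'GL_8(2)}} := (N0 H * Sym3)%g.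

(* Main.v *)
Require Import Defs.
From mathcomp Require Import all_boot all_order all_algebra all_fingroup.
From mathcomp Require Import cyclic mxtens.

Set Implicit Arguments.
Unset Strict Implicit.
Unset Printing Implicit Defensive.

(** Label the point E_ijk of the Segre variety by (i, j, k), read as a vector t
    of (Z/3)^3, and let delta_1, delta_2, delta_3 be its standard basis. As u_0,
    u_1, u_2 sum to 0, the points labelled t, t + delta_d, t - delta_d form a
    line, that is, sum to 0. The definition of W on the basis says that
                 W (pt t) = sum over d of pt (t + delta_d)
    for all 27 labels ([W_pt]): W is the sum h_1 + h_2 + h_3 of the three
    commuting order 3 maps which turn one tensor factor by u_i -> u_(i+1). Since
    h_d^2 = h_d + 1 in characteristic 2, squaring gives W^2 = W + 1 ([W_sq]), so
    W has order 3 and W^-1 = W + 1.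

    Let A stabilize the variety. It permutes the points, and it maps the three
    lines through pt t to the three lines through A (pt t), because no other
    line of the variety passes through a point ([pt_neighbour]). So A (W (pt t))
    is a sum of three points, one on each line through A (pt t), just as
    W (A (pt t)) is; on each line the two sums either use the same point or use
    the two points other than A (pt t), whose difference is A (pt t). Hence
              A (W x) = W (A x) + c(x) A x, with c(x) in GF(2),
    for each point x of the variety ([twisted_at]). Linearity along a line
    through x forces c to be constant on it, two points of a line being linearly
    independent; lines connect the variety and its points span the space, so
    A W = (W + c) A for a single scalar c ([GS_twisted]). Thus A W A^-1 is W or
    W + 1 = W^-1, so A normalizes <[W]>.

    When the action of A on labels is known, c is the parity of the number of
    directions that A reverses ([shift_twisted]). For J, which sends the label t
    to (1, 1, 1) - t, all three directions are reversed, so c = 1 and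
    J W J^-1 = W^2. An element of N_0 reverses an even number of directions,
    those d with a_d outside H ([mem_index2]), and a permutation of the factors
    reverses none, so G_S^0 centralizes W ([GS0_twisted]) and cannot contain
    J. *)

Import GRing.Theory.
Local Open Scope ring_scope.

(** * Characteristic 2 and indices modulo 3 *)

Lemma F2_bool (c : 'F_2) : c = (c != 0)%:R.
Proof. by case: c => [[|[|c]] lt_c] //; apply: val_inj. Qed.

Lemma addvv_F2 (V : lmodType 'F_2) (x : V) : x + x = 0.
Proof.
by rewrite -[x]scale1r -scalerDl (_ : 1 + 1 = 0) ?scale0r //; apply: val_inj.
Qed.

Lemma oppv_F2 (V : lmodType 'F_2) (x : V) : - x = x.
Proof. by apply/esym/eqP; rewrite -addr_eq0 addvv_F2. Qed.

Lemma sum_sym_F2 (V : lmodType 'F_2) (Q : 'I_3 -> 'I_3 -> V) :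
  (forall i j, Q i j = Q j i) -> \sum_i \sum_j Q i j = \sum_i Q i i.
Proof.
move=> Qsym; rewrite !big_ord_recl !big_ord0 !addr0.
rewrite (Qsym (lift ord0 ord0) ord0) (Qsym (lift ord0 (lift ord0 ord0)) ord0).
rewrite (Qsym (lift ord0 (lift ord0 ord0)) (lift ord0 ord0)).
rewrite [LHS](AC ((1*2)*((1*2)*(1*2))) ((1*(5*9))*((2*4)*(3*7)*(6*8)))) /=.
by rewrite !addvv_F2 !addr0.
Qed.

Lemma ord3_cases (i : 'I_3) : [\/ i = 0, i = 1 | i = -1].
Proof.
by case: i => [[|[|[|i]]] lt_i] //; [constructor 1 | constructor 2 | constructor 3];
  apply: val_inj.
Qed.

Definition unitsign (b : bool) : 'I_3 := if b then -1 else 1.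

(** Sym(3) is the affine group of Z/3: a rotation satisfies f (i + 1) = f i + 1
    and a reflection f (i + 1) = f i - 1. *)
Lemma injective3_affine (f : 'I_3 -> 'I_3) : injective f ->
  exists b, forall i, f (i + 1) = f i + unitsign b.
Proof.
move=> f_inj; exists (f 1 != f 0 + 1) => i.
(* f is a rotation exactly when it maps 0, 1 to consecutive elements. *)
have f01 : f 1 != f 0 by rewrite (inj_eq f_inj).
have f02 : f (- 1) != f 0 by rewrite (inj_eq f_inj).
have f12 : f (- 1) != f 1 by rewrite (inj_eq f_inj).
have -> : i + 1 = (if i == 0 then 1 else if i == 1 then -1 else 0).
  by case: (ord3_cases i) => ->; apply: val_inj.
move: f01 f02 f12; case: (ord3_cases i) => ->;
  case: (ord3_cases (f 0)) => ->; case: (ord3_cases (f 1)) => ->;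
  case: (ord3_cases (f (-1))) => -> //= _ _ _; exact: val_inj.
Qed.

(** * Labels of points *)

Notation label := {ffun 'I_3 -> 'I_3}.

Definition delta (d : 'I_3) : label := [ffun e => (e == d)%:R].

(** A move along direction [d], backwards when [b] holds. *)
Definition step (b : bool) (d : 'I_3) : label := if b then - delta d else delta d.

Lemma step_id b d : step b d d = unitsign b.
Proof. by case: b; rewrite !ffunE eqxx. Qed.

Lemma step_out b d e : e != d -> step b d e = 0.
Proof. by move/negPf=> ned; case: b; rewrite !ffunE ned ?oppr0. Qed.

Lemma step_dir b b' d d' : step b d = step b' d' -> d = d'.
Proof.
move=> /ffunP/(_ d); rewrite step_id; case: (eqVneq d d') => // ned.
by rewrite step_out //; case: b.
Qed.

(** * Pure tensors *)

(** The index of a coordinate of V_8 as a triple of indices of coordinates of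
    V_2; the default value of [nth] is the digit of the third factor. *)
Definition digit (q : 'I_8) (d : 'I_3) : 'I_2 :=
  let p := @mxtens_unindex (2 * 2) 2 q in
  nth p.2 [:: (mxtens_unindex p.1).1; (mxtens_unindex p.1).2] d.

Lemma digit_inj q q' : (forall d, digit q d = digit q' d) -> q = q'.
Proof.
move=> eq_d; apply: (can_inj (@mxtens_unindexK (2 * 2) 2)).
apply/eqP; rewrite xpair_eqE; apply/andP; split; last exact/eqP/(eq_d ord_max).
apply/eqP/(can_inj (@mxtens_unindexK 2 2))/eqP.
by rewrite xpair_eqE; apply/andP; split; [exact/eqP/(eq_d 0)|exact/eqP/(eq_d 1)].
Qed.

Definition pure (v : 'I_3 -> V2) : V8 := tens3 (v 0) (v 1) (v ord_max).

Lemma pureE v q j : pure v q j = \prod_d v d (digit q d) 0.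
Proof.
rewrite !big_ord_recl big_ord0 mulr1 mulrA.
rewrite !mxE !(ord1 (mxtens_unindex _).1) !(ord1 (mxtens_unindex _).2).
congr (v _ _ _ * v _ _ _ * v _ _ _); exact: val_inj.
Qed.

Definition triple (i j k : 'I_3) : label :=
  [ffun d : 'I_3 => nth 0 [:: i; j; k] d].

Lemma tens3_mxM (a1 a2 a3 : 'M['F_2]_2) (x y z : V2) :
  tens3_mx a1 a2 a3 *m tens3 x y z = tens3 (a1 *m x) (a2 *m y) (a3 *m z).
Proof.
have mulE := tensmx_mul (a1 *t a2) a3 (x *t y) z.
by rewrite (tensmx_mul a1 a2 x y) in mulE.
Qed.

(** * Two facts on finite groups *)

Lemma sqr_index2 (gT : finGroupType) (G H : {group gT}) (a : gT) :
  H \subset G -> #|G : H|%g = 2 -> a \in G -> (a * a)%g \in H.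
Proof.
move=> sHG iH aG; have [aH | naH] := boolP (a \in H); first by rewrite groupM.
have cosetE : (H :* a = G :\: H)%g by apply: rcoset_index2; rewrite ?inE ?naH.
apply/negPn/negP => naa; have : (a * a)%g \in (H :* a)%g.
  by rewrite cosetE inE naa groupM.
by rewrite mem_rcoset mulgK (negPf naH).
Qed.

Lemma conj_cycle_stable (gT : finGroupType) (a w : gT) :
  (a * w * a^-1 = w \/ a * w * a^-1 = w^-1)%g ->
  (a *: <[w]> :* a^-1 = <[w]>)%g.
Proof.
have -> : (a *: <[w]> :* a^-1 = <[a * w * a^-1]>)%g.
  have -> : (a * w * a^-1 = w ^ a^-1)%g by rewrite conjgE invgK mulgA.
  by rewrite cycleJ conjsgE invgK mulgA.
by case=> ->; rewrite ?cycleV.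
Qed.

Lemma GLval_inj n : injective (@GLval n 'F_2).
Proof. exact: val_inj. Qed.

(** * The 27 points and their lines *)

Section Frame.

Variable u : 'I_3 -> V2.
Hypothesis hu : nonzero_enum u.

Let u_inj : injective u. Proof. by case: hu. Qed.
Let u_neq0 i : u i != 0. Proof. by case: hu. Qed.

Lemma nonzero_enum_onto v : v != 0 -> exists i, v = u i.
Proof.
move=> v0.
have: v \in [set u i | i : 'I_3].
  have -> : [set u i | i : 'I_3] = [set~ 0].
    apply/eqP; rewrite eqEcard; apply/andP; split.
      by apply/subsetP=> _ /imsetP[i _ ->]; rewrite !inE u_neq0.
    by rewrite cardsC1 card_mx card_Fp // card_imset // card_ord.
  by rewrite !inE.
by case/imsetP=> i _ ->; exists i.
Qed.

Lemma u_line i : u i + u (i + 1) + u (i - 1) = 0.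
Proof.
have ne : u i + u (i + 1) != 0.
  rewrite addr_eq0 oppv_F2 (inj_eq u_inj).
  by case: (ord3_cases i) => ->.
have [j def_j] := nonzero_enum_onto ne.
suff -> : i - 1 = j by rewrite -def_j addvv_F2.
have: j != i.
  apply/eqP=> eji; move: def_j; rewrite eji => /eqP.
  by rewrite -[X in _ == X]addr0 (inj_eq (addrI _)) (negPf (u_neq0 _)).
have: j != i + 1.
  apply/eqP=> eji; move: def_j; rewrite eji => /eqP.
  by rewrite -[X in _ == X]add0r (inj_eq (addIr _)) (negPf (u_neq0 _)).
by case: (ord3_cases i) => ->; case: (ord3_cases j) => -> //= _ _; apply: val_inj.
Qed.

Definition pt (t : label) : V8 := pure (fun d => u (t d)).

Lemma pt_line t d : pt t + pt (t + delta d) + pt (t - delta d) = 0.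
Proof.
apply/matrixP=> q j; rewrite [LHS]mxE [X in X + _]mxE !pureE [RHS]mxE.
have others (s : label) : (forall i, i != d -> s i = t i) ->
    \prod_(i < 3 | i != d) u (s i) (digit q i) 0 =
    \prod_(i < 3 | i != d) u (t i) (digit q i) 0.
  by move=> eqs; apply: eq_bigr => i ne; rewrite eqs.
rewrite !(bigD1 (P := predT) d) //= (others (t + _)) 1?(others (t - _)).
- rewrite !ffunE eqxx -!mulrDl; have /matrixP/(_ (digit q d) 0) := u_line (t d).
  by rewrite !mxE => ->; rewrite mul0r.
- by move=> i /negPf ne; rewrite !ffunE ne oppr0 addr0.
- by move=> i /negPf ne; rewrite !ffunE ne addr0.
Qed.

Lemma pt_step b t d : pt (t + step b d) = pt (t + delta d) + b%:R *: pt t.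
Proof.
case: b => /=; rewrite ?scale0r ?addr0 // scale1r.
by apply/eqP; rewrite -subr_eq0 oppv_F2 addrC [X in X + _]addrC pt_line.
Qed.

(** The standard basis of V_8 consists of points of the Segre variety, since the
    standard basis of V_2 is among the u_i. *)
Lemma pt_span (M : 'M['F_2]_8) : (forall t, M *m pt t = 0) -> M = 0.
Proof.
move=> M0; apply/matrixP=> r q.
have /fin_all_exists[t Pt] : forall d, exists i, delta_mx (digit q d) 0 = u i.
  move=> d; apply: nonzero_enum_onto; apply/eqP=> /matrixP/(_ (digit q d) 0).
  by rewrite !mxE !eqxx.
have def_q : pt [ffun d => t d] = delta_mx q 0.
  apply/matrixP=> q' j; rewrite pureE mxE (ord1 j) andbT /=.
  under eq_bigr => d _ do rewrite ffunE -Pt mxE andbT.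
  case: eqP => [-> | ne]; first by rewrite big1 // => d _; rewrite eqxx.
  have [d ned] : exists d, digit q' d != digit q d.
    apply/existsP; rewrite -negb_forall; apply/forallP => eqd.
    by apply: ne; apply: digit_inj => d; exact/eqP.
  by rewrite (bigD1 d) //= (negPf ned) mul0r.
have := M0 [ffun d => t d]; rewrite def_q -colE => /matrixP/(_ r 0).
by rewrite !mxE.
Qed.

(** The form v -> det (u_i, v) on V_2; signs do not matter in characteristic 2. *)
Definition wedge (i : 'I_3) : 'rV['F_2]_2 := \row_j u i (rev_ord j) 0.

Lemma wedgeE i j : (wedge i *m u j) 0 0 = (i != j)%:R.
Proof.
rewrite mxE big_ord_recl big_ord1 !mxE.
have -> : rev_ord (ord0 : 'I_2) = lift ord0 ord0 by apply: val_inj.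
have -> : rev_ord (lift ord0 ord0 : 'I_2) = ord0 by apply: val_inj.
case: (eqVneq i j) => [-> | ne]; first rewrite mulrC.
  exact: (@addvv_F2 ('F_2 : nzRingType)^o).
(* The vectors u_i and u_j are distinct and nonzero: check all values of their
   four coordinates. *)
have ext k l : u k ord0 0 = u l ord0 0 ->
    u k (lift ord0 ord0) 0 = u l (lift ord0 ord0) 0 -> k = l.
  move=> e0 e1; apply: u_inj; apply/matrixP=> r c; rewrite (ord1 c).
  by case: (unliftP ord0 r) => [r' | ] -> //; rewrite (ord1 r').
have nz k : ~ (u k ord0 0 = 0 /\ u k (lift ord0 ord0) 0 = 0).
  case=> e0 e1; have /eqP[] := u_neq0 k; apply/matrixP=> r c; rewrite (ord1 c) mxE.
  by case: (unliftP ord0 r) => [r' | ] -> //; rewrite (ord1 r').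
have := nz i; have := nz j; have := fun e0 e1 => elimN eqP ne (ext i j e0 e1).
by rewrite (F2_bool (u i ord0 0)) (F2_bool (u i (lift ord0 ord0) 0))
  (F2_bool (u j ord0 0)) (F2_bool (u j (lift ord0 ord0) 0));
  do 4!case: (_ != 0) => //=; move=> h1 h2 h3;
  try (exfalso; tauto); apply: val_inj.
Qed.

Lemma tens3_form (f : 'I_3 -> 'rV['F_2]_2) :
  exists F : 'rV['F_2]_8, forall v,
    (F *m pure v) 0 0 = \prod_d (f d *m v d) 0 0.
Proof.
exists ((f 0 *t f 1) *t f ord_max : 'M['F_2]_(1 * 1 * 1, 2 * 2 * 2)) => v.
have mulE := tensmx_mul (f 0 *t f 1) (f ord_max) (v 0 *t v 1) (v ord_max).
rewrite (tensmx_mul (f 0) (f 1) (v 0) (v 1)) in mulE.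
refine (etrans (congr1 (fun M : 'M_1 => M 0 0) mulE) _).
rewrite [LHS]mxE [X in X * _]mxE !big_ord_recl big_ord0 mulr1 mulrA.
have entry (M : 'M['F_2]_1) i j : M i j = M 0 0 by rewrite !ord1.
congr (_ * _ * _); rewrite [LHS]entry; congr ((f _ *m v _) _ _); exact: val_inj.
Qed.

(** The product of the forms det (u_(s d), -): it detects whether a label avoids
    [s] in all three positions. *)
Lemma separating_form (s : label) :
  exists F : 'rV['F_2]_8, forall t, (F *m pt t) 0 0 = [forall d, s d != t d]%:R.
Proof.
have [F FE] := tens3_form (fun d => wedge (s d)).
exists F => t; rewrite FE; under eq_bigr => d _ do rewrite wedgeE.
case: forallP => [ne | /forallP]; first by rewrite big1 // => d _; rewrite ne.
by rewrite negb_forall => /existsP[d ned]; rewrite (bigD1 d) //= (negPf ned) mul0r.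
Qed.

Lemma pt_inj : injective pt.
Proof.
move=> t t' eqP_tt'; apply/ffunP=> d; apply/eqP/negPn/negP=> ned.
have [F FE] := separating_form [ffun e => if e == d then t' d else t e + 1].
have := FE t; rewrite eqP_tt' FE.
case: forallP => [/(_ d)|_]; first by rewrite !ffunE eqxx eqxx.
case: forallP => // [[]] e; rewrite ffunE; case: (eqVneq e d) => [-> | _].
  by rewrite eq_sym.
by case: (ord3_cases (t e)) => ->.
Qed.

Lemma pt_neq0 t : pt t != 0.
Proof.
have [F FE] := separating_form (t + [ffun => 1]).
apply/eqP=> Pt0; have := FE t; rewrite Pt0 mulmx0 mxE.
case: forallP => // [[]] d; rewrite !ffunE.
by case: (ord3_cases (t d)) => ->.
Qed.

(** The only lines on the Segre variety are those in a coordinate direction. Say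
    that pt t + pt t' = pt t'', that t, t' differ at d and that t, t'' differ at
    e. If d <> e, a label s with s d = t' d and s e = t'' e that avoids t
    everywhere gives a form which vanishes at pt t' and pt t'' and not at pt t,
    a contradiction. So t and t' differ at one position only. *)
Lemma pt_neighbour t t' t'' : pt t + pt t' = pt t'' -> exists d b, t' = t + step b d.
Proof.
move=> sumP.
have dif r r' : pt r != pt r' -> exists d, r d != r' d.
  move=> neP; apply/existsP; rewrite -negb_forall; apply: contraNN neP.
  by move/forallP=> eqd; apply/eqP; congr pt; apply/ffunP=> d; apply/eqP.
have [d ned] : exists d, t d != t' d.
  by apply: dif; apply: contraNneq (pt_neq0 t'') => eqPt; rewrite -sumP eqPt addvv_F2.
have [e nee] : exists e, t e != t'' e.
  apply: dif; apply: contraNneq (pt_neq0 t') => eqPt.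
  by rewrite -(addKr (pt t) (pt t')) sumP -eqPt addNr.
have only d' : t d' != t' d' -> d' = e.
  move=> ned'; apply/eqP/negPn/negP=> de.
  have [F FE] := separating_form
    [ffun i => if i == d' then t' i else if i == e then t'' i else t i + 1].
  have : (F *m (pt t + pt t')) 0 0 = (F *m pt t'') 0 0 by rewrite sumP.
  rewrite mulmxDr mxE !FE.
  case: forallP => [_|[]]; last first.
    move=> i; rewrite ffunE; case: (eqVneq i d') => [-> |_]; first by rewrite eq_sym.
    case: (eqVneq i e) => [-> |_]; first by rewrite eq_sym.
    by case: (ord3_cases (t i)) => ->.
  case: forallP => [/(_ d')|_]; first by rewrite ffunE eqxx eqxx.
  case: forallP => [/(_ e)|_ //].
  by rewrite ffunE (negPf (_ : e != d')) ?eqxx // eq_sym.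
exists e; have ne_e : t e != t' e by rewrite -(only d ned).
exists (t' e != t e + 1); apply/ffunP=> i; rewrite ffunE.
have [-> | nei] := eqVneq i e; last first.
  rewrite step_out // addr0; apply/eqP/negPn/negP=> ne; case/eqP: nei.
  by apply: only; rewrite eq_sym.
rewrite step_id; move: ne_e.
by case: (ord3_cases (t e)) => ->; case: (ord3_cases (t' e)) => -> //= _; apply: val_inj.
Qed.

(** The eight points labelled by 0 and 1 only form a basis. This is the way to
    extend to all points what is prescribed for e_1, ..., e_8: a label with an
    entry -1 at d is on a line with two labels that have fewer entries -1. *)
Lemma line_additive_eq0 (G : label -> V8) :
  (forall t d, G t + G (t + delta d) + G (t - delta d) = 0) ->
  (forall i j k : bool, G (triple i%:R j%:R k%:R) = 0) ->
  forall t, G t = 0.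
Proof.
move=> Gline G0 t; have [n] := ubnP #|[set d | t d == -1]|.
elim: n t => // n IHn t; rewrite ltnS => le_n.
case: (pickP (fun d => t d == -1)) => [d td | no].
  have smaller (s : label) : (forall e, e != d -> s e = t e) -> s d != -1 -> G s = 0.
    move=> eq_s sd; apply: IHn; apply: leq_trans le_n; apply: proper_card.
    apply/properP; split; last by exists d; rewrite inE.
    apply/subsetP=> e; rewrite !inE; case: (eqVneq e d) => [-> | ne].
      by rewrite (negPf sd).
    by rewrite eq_s.
  have := Gline t d; rewrite (smaller (t + _)) ?(smaller (t - _)) ?addr0 //.
  - by move=> e ne; rewrite !ffunE (negPf ne) subr0.
  - by rewrite !ffunE eqxx (eqP td).
  - by move=> e ne; rewrite !ffunE (negPf ne) addr0.
  - by rewrite !ffunE eqxx (eqP td).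
have bit d : t d = (t d != 0)%:R.
  by have := no d; case: (ord3_cases (t d)) => -> // _; apply: val_inj.
rewrite -(G0 (t 0 != 0) (t 1 != 0) (t (-1) != 0)); congr G; apply/ffunP=> d.
by rewrite ffunE; case: (ord3_cases d) => ->; rewrite {1}bit.
Qed.

Lemma E_pt i j k : E u i j k = pt (triple i j k).
Proof. by rewrite /pt /pure !ffunE. Qed.

Lemma GS_maps_pt (A : {'GL_8(2)}) : A \in GS u ->
  forall t, exists s, GLval A *m pt t = pt s.
Proof.
rewrite inE => /eqP stab t.
have: pt t \in Segre u by apply/imsetP; exists (t 0, t 1, t ord_max).
move/(imset_f (GLact A)); rewrite stab => /imsetP[[[i j] k] _ eqA].
by exists (triple i j k); rewrite -E_pt -eqA.
Qed.

Lemma maps_pt_GS (A : {'GL_8(2)}) (g : label -> label) :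
  (forall t, GLval A *m pt t = pt (g t)) -> A \in GS u.
Proof.
move=> actA; rewrite inE eqEcard; apply/andP; split; last first.
  rewrite (card_imset (Segre u)) // => x y.
  rewrite /GLact => /(congr1 (mulmx (GLval A^-1))).
  by rewrite !mulmxA -!GL_MxE mulVg !mul1mx.
apply/subsetP=> _ /imsetP[_ /imsetP[[[i j] k] _ ->] ->] /=.
rewrite E_pt /GLact actA.
by apply/imsetP; exists (g (triple i j k) 0,
  g (triple i j k) 1, g (triple i j k) ord_max).
Qed.

(** * Commutation with W up to a scalar *)

Section Triality.

Variable W : 'M['F_2]_8.
Hypothesis W_shift : forall t, W *m pt t = \sum_d pt (t + delta d).

(** With h_d the shift of direction d, (h_1 + h_2 + h_3)^2 is the sum of the
    h_d^2 = h_d + 1, since the mixed terms cancel in pairs. *)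
Lemma W_sq : W *m W = W + 1%:M.
Proof.
apply/eqP; rewrite -subr_eq0 oppv_F2; apply/eqP/pt_span => t.
rewrite !mulmxDl mul1mx -mulmxA W_shift mulmx_sumr.
under eq_bigr => d _ do rewrite W_shift.
set Q := fun d e => pt (t + delta d + delta e).
have Qsym d e : Q d e = Q e d by rewrite /Q addrAC.
have Qdiag d : Q d d = pt t + pt (t + delta d).
  rewrite /Q -addrA (_ : delta d + delta d = step true d).
    by rewrite pt_step scale1r addrC.
  by apply/ffunP=> e; rewrite !ffunE; case: (e == d); apply: val_inj.
rewrite (eq_bigr (fun d => \sum_e Q d e)) // sum_sym_F2 //.
under [X in X + _]eq_bigr => d _ do rewrite Qdiag.
rewrite big_split /= sumr_const card_ord.
rewrite [LHS](AC (2*2) ((1*4)*(2*3))) /= addvv_F2 addr0 -mulrSr.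
by rewrite (mulrnA _ 2 2) mulr2n addvv_F2.
Qed.

(** As W^2 = W + 1, this says that A W A^-1 is W if c = 0 and W^2 if c = 1. *)
Definition twisted (A : 'M['F_2]_8) (c : 'F_2) := A *m W = W *m A + c *: A.

(** Both A (W x) and W (A x), for x = pt t, pick one point on each line through
    A x. The choices in direction pi d differ exactly when b d holds, and then
    the two chosen points differ by A x. *)
Lemma twisted_at (A : 'M['F_2]_8) s t (pi : 'I_3 -> 'I_3) (b : 'I_3 -> bool) :
  injective pi -> A *m pt t = pt s ->
  (forall d, A *m pt (t + delta d) = pt (s + step (b d) (pi d))) ->
  A *m W *m pt t = W *m A *m pt t + (\sum_d (b d)%:R) *: (A *m pt t).
Proof.
move=> pi_inj At Ad; rewrite -!mulmxA W_shift At W_shift mulmx_sumr.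
under eq_bigr => d _ do rewrite Ad pt_step.
rewrite big_split /= scaler_suml; congr (_ + _).
by rewrite [RHS](reindex_inj pi_inj).
Qed.

(** The scalar exists at each point because A permutes the lines through it,
    and it is the same at all points because it cannot change along a line. *)
Lemma GS_twisted (A : {'GL_8(2)}) : A \in GS u -> exists c, twisted (GLval A) c.
Proof.
move=> /GS_maps_pt/fin_all_exists[g gP].
have A_inj : injective (mulmx (GLval A) : V8 -> V8).
  move=> x y /(congr1 (mulmx (GLval A^-1))).
  by rewrite !mulmxA -!GL_MxE mulVg !mul1mx.
have g_inj : injective g.
  by move=> t t' eqg; apply/pt_inj/A_inj; rewrite !gP eqg.
have line t d : pt (g t) + pt (g (t + delta d)) = pt (g (t - delta d)).
  by rewrite -!gP -mulmxDr; congr (_ *m _); rewrite addrC (pt_step true) scale1r.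
have local t : exists c : 'F_2,
    GLval A *m W *m pt t = W *m GLval A *m pt t + c *: (GLval A *m pt t).
  have /fin_all_exists[pi /fin_all_exists[b gS]] :
      forall d, exists e b, g (t + delta d) = g t + step b e.
    by move=> d; apply: pt_neighbour (line t d).
  exists (\sum_d (b d)%:R); apply: (@twisted_at _ (g t) _ pi) => //; last first.
    by move=> d; rewrite gP gS.
  (* Two of the three lines cannot have the same image: otherwise A identifies
     pt (t + delta d) with a point of the line in direction d'. *)
  move=> d d' eqpi; case: (eqVneq (b d) (b d')) => [eqb | neb].
    apply: (@step_dir false false); apply: (addrI t); apply: g_inj.
    by rewrite !gS eqb eqpi.
  apply: (@step_dir false true); apply: (addrI t); apply/pt_inj/A_inj.
  rewrite (pt_step true) mulmxDr scale1r !gP !gS eqpi !pt_step.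
  by case: (b d) (b d') neb => [] [] //= _;
    rewrite !scale1r !scale0r !addr0 // -addrA addvv_F2 addr0.
have /fin_all_exists[c cP] := local.
have c_step t d : c (t + delta d) = c t.
  (* Compare the scalars at the three points of the line, using linearity at
     the third: c (t + delta d) y + c t x = c (t - delta d) (y + x) with x, y
     nonzero and distinct. *)
  have := cP (t - delta d); rewrite (pt_step true) scale1r !mulmxDr !cP addrACA.
  move/addrI; rewrite !gP.
  have: pt (g t) != 0 /\ pt (g (t + delta d)) != 0 by rewrite !pt_neq0.
  move: (pt (g t)) (pt (g (t + delta d))) => x y [/eqP x0 /eqP y0].
  rewrite (F2_bool (c t)) (F2_bool (c (t + _))) (F2_bool (c (t - _))).
  case: (c t != 0); case: (c (t + _) != 0); case: (c (t - _) != 0) => //=;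
    rewrite !(scale0r, scale1r, add0r, addr0) => eq_xy //.
  - by case: y0; apply: (addIr x); rewrite add0r -eq_xy.
  - by case: x0; apply: (addrI y); rewrite addr0 -eq_xy.
have c_shift : forall v t, c (t + v) = c t.
  move=> v; have ->: v = \sum_d delta d *+ v d.
    apply/ffunP=> e; rewrite sum_ffunE (bigD1 e) //= big1 => [|d ne].
      by rewrite ffunMnE ffunE eqxx addr0; case: (ord3_cases (v e)) => ->; apply: val_inj.
    by rewrite ffunMnE ffunE eq_sym (negPf ne) mul0rn.
  apply: (big_ind (fun v => forall t, c (t + v) = c t)).
  - by move=> t; rewrite addr0.
  - by move=> v1 v2 c1 c2 t; rewrite addrA c2 c1.
  move=> d _; elim: (v d : nat) => [|n IHn] t; first by rewrite addr0.
  by rewrite mulrS addrA IHn c_step.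
exists (c 0); apply/eqP; rewrite -subr_eq0; apply/eqP/pt_span => t.
by rewrite mulmxBl mulmxDl cP -scalemxAl -(c_shift t 0) add0r subrr.
Qed.

Lemma shift_twisted (A : 'M['F_2]_8) (g : label -> label) (pi : 'I_3 -> 'I_3)
    (b : 'I_3 -> bool) :
  injective pi -> (forall t, A *m pt t = pt (g t)) ->
  (forall t d, g (t + delta d) = g t + step (b d) (pi d)) ->
  twisted A (\sum_d (b d)%:R).
Proof.
move=> pi_inj gP gS; apply/eqP; rewrite -subr_eq0; apply/eqP/pt_span => t.
rewrite mulmxBl mulmxDl -scalemxAl.
rewrite (twisted_at pi_inj (gP t) (s := g t) (b := b)) ?subrr // => d.
by rewrite gP gS.
Qed.

End Triality.

(** * The maps W and J on the 27 points *)

Lemma pt_flip (t s : label) d (b : bool) :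
  t d = b%:R -> s d = (~~ b)%:R -> (forall e, e != d -> s e = t e) ->
  pt (t + delta d) = pt s + b%:R *: pt t.
Proof.
move=> td sd eq_s; have -> : s = t + step b d.
  apply/ffunP=> e; rewrite ffunE; have [-> | ne] := eqVneq e d.
    by rewrite step_id td sd; case: b {td sd}; apply: val_inj.
  by rewrite step_out // addr0 eq_s.
by rewrite pt_step -addrA addvv_F2 addr0.
Qed.

(** On 0/1 labels the sum over directions takes the shape of the formulas that
    define W: the three neighbours in the cube, plus the point itself when the
    label has an odd number of entries 1. *)
Lemma pt_flip_triple (i j k : bool) :
  \sum_d pt (triple i%:R j%:R k%:R + delta d) =
  E u (~~ i)%:R j%:R k%:R + E u i%:R (~~ j)%:R k%:R + E u i%:R j%:R (~~ k)%:R
  + (i (+) j (+) k)%:R *: E u i%:R j%:R k%:R.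
Proof.
rewrite !big_ord_recl big_ord0 addr0.
have [f0 f1 f2] : [/\
  pt (triple i%:R j%:R k%:R + delta 0) =
    E u (~~ i)%:R j%:R k%:R + i%:R *: E u i%:R j%:R k%:R,
  pt (triple i%:R j%:R k%:R + delta 1) =
    E u i%:R (~~ j)%:R k%:R + j%:R *: E u i%:R j%:R k%:R
  & pt (triple i%:R j%:R k%:R + delta (-1)) =
    E u i%:R j%:R (~~ k)%:R + k%:R *: E u i%:R j%:R k%:R].
  split; rewrite !E_pt; apply: pt_flip; rewrite ?ffunE // => e;
    by rewrite /triple !ffunE; case: (ord3_cases e) => -> //; rewrite eqxx.
have -> : lift ord0 (lift ord0 ord0) = -1 :> 'I_3 by apply: val_inj.
have -> : lift ord0 ord0 = 1 :> 'I_3 by apply: val_inj.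
have -> : (i (+) j (+) k)%:R = i%:R + (j%:R + k%:R) :> 'F_2.
  by case: i j k {f0 f1 f2} => [] [] []; apply: val_inj.
rewrite f0 f1 f2 !scalerDl.
by rewrite [LHS](AC (2*(2*2)) ((1*3*5)*(2*(4*6)))).
Qed.

Lemma W_pt (W : {'GL_8(2)}) : W_spec u W ->
  forall t, GLval W *m pt t = \sum_d pt (t + delta d).
Proof.
move=> hW t; apply/eqP; rewrite -subr_eq0 oppv_F2; apply/eqP; move: t.
apply: line_additive_eq0 => [t d | i j k].
  rewrite [LHS](AC ((2*2)*2) ((1*3*5)*(2*4*6))) /= -!mulmxDr pt_line mulmx0 add0r.
  rewrite -!big_split big1 //= => e _.
  by rewrite [t + delta d + _]addrAC [t - delta d + _]addrAC pt_line.
rewrite pt_flip_triple -E_pt; apply/eqP; rewrite addr_eq0 oppv_F2; apply/eqP.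
case: hW => [[]]; rewrite /GLact /e /=; move: (E u) => F w1 w2 w3 w4 w5 w6 w7 w8.
case: i; case: j; case: k; rewrite /= ?mulr1n ?mulr0n ?scale1r ?scale0r ?addr0.
- by rewrite [LHS]w8 [LHS](AC 4 (4*3*2*1)).
- by rewrite [LHS]w3 [LHS](AC 3 (2*1*3)).
- by rewrite [LHS]w5 [LHS](AC 3 (2*3*1)).
- by rewrite [LHS]w2 [LHS](AC 4 (2*3*4*1)).
- by rewrite [LHS]w7 [LHS](AC 3 (3*2*1)).
- by rewrite [LHS]w4 [LHS](AC 4 (3*2*4*1)).
- by rewrite [LHS]w6 [LHS](AC 4 (3*4*2*1)).
- exact: w1.
Qed.

Lemma J_pt (J : {'GL_8(2)}) : J_spec u J ->
  forall t, GLval J *m pt t = pt ([ffun => 1] - t).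
Proof.
move=> hJ t; apply/eqP; rewrite -subr_eq0 oppv_F2; apply/eqP; move: t.
apply: line_additive_eq0 => [t d | i j k].
  rewrite [LHS](AC ((2*2)*2) ((1*3*5)*(2*4*6))) /= -!mulmxDr pt_line mulmx0 add0r.
  by rewrite opprB opprD !addrA addrAC [_ + delta d - t]addrAC pt_line.
rewrite (_ : _ - _ = triple (~~ i)%:R (~~ j)%:R (~~ k)%:R); last first.
  apply/ffunP=> d; rewrite /triple !ffunE; case: (ord3_cases d) => -> /=;
    [case: i | case: j | case: k]; exact: val_inj.
rewrite -!E_pt; apply/eqP; rewrite addr_eq0 oppv_F2; apply/eqP.
have := fun n => hJ n.+1; rewrite /GLact /e => hJ'.
case: i; case: j; case: k;
  [exact: (hJ' 7) | exact: (hJ' 2) | exact: (hJ' 4) | exact: (hJ' 1)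
  | exact: (hJ' 6) | exact: (hJ' 3) | exact: (hJ' 5) | exact: (hJ' 0)].
Qed.

(** * The elements of the group G_S^0 *)

Lemma GL_u (a : {'GL_2(2)}) :
  exists2 f, injective f & forall i, GLval a *m u i = u (f i).
Proof.
have a_inj : injective (mulmx (GLval a) : V2 -> V2).
  move=> x y /(congr1 (mulmx (GLval a^-1))).
  by rewrite !mulmxA -!GL_MxE mulVg !mul1mx.
have /fin_all_exists[f fP] : forall i, exists j, GLval a *m u i = u j.
  move=> i; apply: nonzero_enum_onto; rewrite -(mulmx0 _ (GLval a)).
  by rewrite (inj_eq a_inj).
by exists f => // i j eqf; apply/u_inj/a_inj; rewrite !fP eqf.
Qed.

Section Index2.

Variable H : {group {'GL_2(2)}}.
Hypothesis indexH : #|'GL_2(2) : H|%g = 2.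

(** [directed false] holds for the rotations of u_0, u_1, u_2 and
    [directed true] for the reflections. *)
Definition directed (b : bool) (a : {'GL_2(2)}) :=
  exists2 f, (forall i, GLval a *m u i = u (f i)) &
             (forall i, f (i + 1) = f i + unitsign b).

(** A rotation has order dividing 3, hence is a square. *)
Lemma rotation_in (a : {'GL_2(2)}) : directed false a -> a \in H.
Proof.
case=> f fP fS.
have fE i : f i = f 0 + i.
  have f1 : f 1 = f 0 + 1 by rewrite -[X in f X]add0r fS.
  case: (ord3_cases i) => ->; rewrite ?addr0 //.
  rewrite -[X in f X](_ : 1 + 1 = -1) ?fS ?f1 -?addrA; last exact: val_inj.
  by congr (_ + _); apply: val_inj.
have a3 : (a * a * a = 1)%g.
  apply: GLval_inj; rewrite !GL_MxE GL_1E; apply/matrixP=> r c.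
  have [i ui] : exists i, delta_mx c 0 = u i.
    apply: nonzero_enum_onto; apply/eqP=> /matrixP/(_ c 0).
    by rewrite !mxE !eqxx.
  have : GLval a *m GLval a *m GLval a *m u i = 1%:M *m u i.
    rewrite -!mulmxA !fP mul1mx; congr u; rewrite (fE (f (f i))) (fE (f i)) (fE i).
    by case: (ord3_cases (f 0)) => ->; case: (ord3_cases i) => ->; apply: val_inj.
  by rewrite -ui -!colE => /matrixP/(_ r 0); rewrite !mxE.
have -> : a = (a * a * (a * a))%g by rewrite mulgA a3 mul1g.
by apply: (sqr_index2 _ indexH); rewrite ?subsetT ?inE.
Qed.

(** H contains all rotations, and it contains no reflection: with one reflection and all
    rotations it would be the whole group. *)
Lemma mem_index2 (a : {'GL_2(2)}) f :
  injective f -> (forall i, GLval a *m u i = u (f i)) ->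
  forall i, f (i + 1) = f i + unitsign (a \notin H).
Proof.
move=> f_inj fP; have [b fS] := injective3_affine f_inj.
suff -> : (a \notin H) = b by [].
case: b fS => fS; last by rewrite rotation_in //; exists f.
apply/negP=> aH; suff HT : (H :=: 'GL_2(2))%g by move: indexH; rewrite HT indexgg.
apply/setP=> g; rewrite !inE; have [h h_inj hP] := GL_u g.
have [[] hS] := injective3_affine h_inj; last by apply: rotation_in; exists h.
rewrite -(groupMr _ aH); apply: rotation_in; exists (h \o f) => i.
  by rewrite GL_MxE -mulmxA fP hP.
have hB j : h (j + unitsign true) = h j + 1.
  have -> : h j = h (j + unitsign true) + unitsign true.
    by rewrite -hS -addrA (_ : unitsign true + 1 = 0) ?addr0 //; apply: val_inj.
  by rewrite -addrA (_ : unitsign true + 1 = 0) ?addr0 //; apply: val_inj.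
by rewrite /= fS hB.
Qed.

(** The factor in N_0 reverses the directions d with a_d outside H, an even
    number of them; the factor in Sym(3) only permutes the directions. *)
Lemma GS0_twisted (W : 'M['F_2]_8) (A : {'GL_8(2)}) :
  (forall t, W *m pt t = \sum_d pt (t + delta d)) ->
  A \in GS0 H -> twisted W (GLval A) 0.
Proof.
move=> W_shift /mulsgP[n s nN sS ->].
have Wn : twisted W (GLval n) 0.
  move: nN; rewrite inE => /existsP[a1 /existsP[a2 /existsP[a3 /andP[/eqP nE even]]]].
  pose a (d : 'I_3) := nth a3 [:: a1; a2] d.
  have /fin_all_exists2[f f_inj fP] := fun d => GL_u (a d).
  have -> : 0 = \sum_d (a d \notin H)%:R :> 'F_2.
    rewrite !big_ord_recl big_ord0 addr0 addrA -!natrD /a /=.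
    by apply/esym/eqP; rewrite -(dvdn_pcharf (pchar_Fp _)) // dvdn2.
  apply: (@shift_twisted W W_shift _ (fun t => [ffun d => f d (t d)]) id) => [|t|t d].
  - exact: inj_id.
  - by rewrite nE /pt /pure tens3_mxM !ffunE -!fP.
  apply/ffunP=> e; rewrite !ffunE; have [-> | ne] := eqVneq e d.
    by rewrite step_id; apply: mem_index2.
  by rewrite step_out // !addr0.
have Ws : twisted W (GLval s) 0.
  move: sS; rewrite inE => /existsP[p /forallP pP].
  rewrite (_ : 0 = \sum_(d < 3) (false)%:R :> 'F_2); last by rewrite big1.
  apply: (@shift_twisted W W_shift _ (fun t => [ffun d => t (p d)]) (p^-1)%g) => [|t|t d].
  - exact: perm_inj.
  - have /eqP := pP [ffun d => u (t d)].
    by rewrite !ffunE /pt /pure !ffunE.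
  apply/ffunP=> e; rewrite !ffunE; congr (_ + (nat_of_bool _)%:R).
  by rewrite -(inj_eq (@perm_inj _ (p^-1)%g)) permK.
move: Wn Ws; rewrite /twisted !scale0r !addr0 GL_MxE => Wn Ws.
by rewrite -mulmxA Ws !mulmxA Wn.
Qed.

End Index2.

End Frame.

(** * The subgroup generated by W *)

Local Close Scope ring_scope.

Theorem mainTheorem2
    (u : 'I_3 -> V2) (hu : nonzero_enum u)
    (H : {group {'GL_2(2)}}) (hH : #|'GL_2(2) : H|%g = 2)
    (W : {'GL_8(2)}) (hW : W_spec u W)
    (J : {'GL_8(2)}) (hJ : J_spec u J) :
  [/\ J \in GS u :\: GS0 H /\ #[J]%g = 2,
      #[W]%g = 3,
      (J * W * J^-1 = W ^+ 2)%g
    & forall A : {'GL_8(2)}, A \in GS u -> (A *: <[W]> :* A^-1 = <[W]>)%g].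
Proof.
Local Open Scope ring_scope.
have W_shift := W_pt hu hW; have J_refl := J_pt hu hJ.
have Wsq := W_sq hu W_shift.
have W3 : (W ^+ 3 = 1)%g.
  apply: GLval_inj; rewrite !expgS expg0 mulg1 GL_1E !GL_MxE Wsq mulmxDr mulmx1.
  by rewrite Wsq addrAC addvv_F2 add0r.
have conj (A : {'GL_8(2)}) c : twisted (GLval W) (GLval A) c ->
    (A * W * A^-1 = W ^+ (c != 0).+1)%g.
  move=> tA; apply: (mulIg A); rewrite mulgKV; apply: GLval_inj.
  rewrite !GL_MxE tA {1}(F2_bool c).
  case: (c != 0); last by rewrite scale0r addr0.
  by rewrite scale1r expgS expg1 GL_MxE Wsq mulmxDl mul1mx.
have J_GS : J \in GS u by apply: maps_pt_GS J_refl.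
have J_tw : twisted (GLval W) (GLval J) 1.
  rewrite (_ : 1 = \sum_(d < 3) true%:R :> 'F_2); last first.
    by rewrite sumr_const card_ord; apply: val_inj.
  apply: (shift_twisted hu W_shift (pi := id)) J_refl _ => // t d.
  by rewrite opprD addrA.
have JWJ : (J * W * J^-1 = W ^+ 2)%g by rewrite (conj _ _ J_tw).
have W_neq1 : (W != 1)%g.
  apply: contra_eqN Wsq => /eqP ->; rewrite GL_1E mul1mx addvv_F2.
  by rewrite oner_eq0.
have oW : #[W]%g = 3 by exact: nt_prime_order.
split => //.
- split.
    rewrite inE J_GS andbT; apply/negP=> /(GS0_twisted hu hH W_shift)/conj.
    rewrite JWJ eqxx expgS expg1 => /(canRL (mulgK _)); rewrite mulgV => W1.
    by rewrite W1 eqxx in W_neq1.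
  have J2 : (J ^+ 2 = 1)%g.
    apply/eqP; rewrite expgS expg1; apply/eqP/GLval_inj.
    rewrite GL_MxE GL_1E; apply/eqP; rewrite -subr_eq0; apply/eqP/(pt_span hu) => t.
    by rewrite mulmxBl mul1mx -mulmxA !J_refl opprB addrCA subrr addr0 subrr.
  apply: nt_prime_order => //; apply: contraNneq W_neq1 => J1; apply/eqP.
  apply: (mulgI W); rewrite mulg1.
  by have := JWJ; rewrite J1 mul1g invg1 mulg1 expgS expg1 => /esym.
move=> A /(GS_twisted hu W_shift)[c /conj cA]; apply: conj_cycle_stable.
rewrite cA; case: (c != 0); [right | left]; rewrite ?expg1 //.
by apply: (mulIg W); rewrite mulVg -expgSr.
Qed.
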